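(* Let $F$ be a field of characteristic zero, $f$ an anti-involution of $F^\times$, and $\Phi_f(U_n)=(U_n,F^\times,\varphi,f)$ a skew gain graph whose underlying graph $U_n$ is a unicyclic graph of order $n$ with unique cycle $C_p$ (of length $p$). Then $$\Psi(\Phi_f(U_n),x)=x^n+\sum_{i=1}^{\lfloor n/2\rfloor}a_{2i}x^{n-2i}+\sum_{i=0}^{\lfloor (n-p)/2\rfloor}b_{p+2i}x^{n-(p+2i)},$$ where $$a_{2i}=\sum_{M\in\mathcal{M}_i(U_n)}(-1)^i\prod_{e\in M}g(\varphi(e)),\qquad b_{p+2i}=\big[\varphi(C_p)+f(\varphi(C_p))\big]\sum_{M\in\mathcal{M}_i(U_n-C_p)}(-1)^{i+1}\prod_{e\in M}g(\varphi(e)).$$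
   Context: An anti-involution of $F^\times$ is a map $f:F^\times\to F^\times$ with $f(f(x))=x$ and $f(xy)=f(y)f(x)$. A skew gain graph $(G,F^\times,\varphi,f)$ is a simple graph $G$ with vertices $v_1,\dots,v_n$ and a function $\varphi$ on oriented edges (both orientations of each edge) with values in $F^\times$ satisfying $\varphi(\overrightarrow{vu})=f(\varphi(\overrightarrow{uv}))$. Its adjacency matrix $A$ has $(i,j)$ entry $\varphi(\overrightarrow{v_iv_j})$ if $v_i\sim v_j$ and $0$ otherwise, and $\Psi(\cdot,x)=\det(xI-A)$. $g(x)=xf(x)$, and for an edge $e=uv$, $g(\varphi(e))$ means $g(\varphi(\overrightarrow{uv}))$ (which equals $g(\varphi(\overrightarrow{vu}))$). For the cycle $C_p:v_0v_1\cdots v_{p-1}v_0$, $\varphi(C_p)=\varphi(\overrightarrow{v_0v_1})\cdots\varphi(\overrightarrow{v_{p-1}v_0})$. $\mathcal{M}_k(H)$ is the set of matchings of $H$ with exactly $k$ edges ($\mathcal{M}_0$ consists of the empty matching, with empty product $1$). $U_n-C_p$ is the graph obtained from $U_n$ by deleting the vertices of $C_p$. A unicyclic graph is a connected graph containing exactly one cycle. *)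

(* Defs.v *)
From HB Require Import structures.
From mathcomp Require Import all_boot all_order all_algebra.

Set Implicit Arguments.
Unset Strict Implicit.
Unset Printing Implicit Defensive.

Import GRing.Theory.
Local Open Scope ring_scope.

(* A map from the multiplicative group of F to itself is encoded by a total
   map F -> F preserving nonzero elements; its value at 0 is irrelevant. *)
Definition anti_involution (F : fieldType) (f : F -> F) : Prop :=
  [/\ forall x, x != 0 -> f x != 0,
      forall x, x != 0 -> f (f x) = x
    & forall x y, x != 0 -> y != 0 -> f (x * y) = f y * f x].

Definition simple_graph (T : finType) (e : rel T) : Prop :=
  symmetric e /\ irreflexive e.

(* The oriented edge from u to v is the pair (u, v) with e u v; phi is
   unconstrained, and never used, on the other pairs. *)
Definition skew_gain (F : fieldType) (T : finType) (e : rel T) (f : F -> F)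
    (phi : T -> T -> F) : Prop :=
  forall u v, e u v -> phi u v != 0 /\ phi v u = f (phi u v).

Definition adjacency (F : fieldType) (n : nat) (e : rel 'I_n)
    (phi : 'I_n -> 'I_n -> F) : 'M[F]_n :=
  \matrix_(i, j) (if e i j then phi i j else 0).

Definition edges (T : finType) (e : rel T) : {set {set T}} :=
  [set [set p.1; p.2] | p : T * T & e p.1 p.2].

Definition matchings (T : finType) (e : rel T) (k : nat) : {set {set {set T}}} :=
  [set M : {set {set T}} | [&& M \subset edges e, trivIset M & #|M| == k]].

(* The vertices of S are kept in the vertex type as isolated vertices, so the
   edges and the matchings are those of the vertex-deleted subgraph. *)
Definition del_vertices (T : finType) (e : rel T) (S : {pred T}) : rel T :=
  [rel u v | [&& e u v, u \notin S & v \notin S]].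

Definition gfun (F : fieldType) (f : F -> F) (x : F) : F := x * f x.

(* An arbitrary orientation of the edge A is chosen; edge_gE shows that the
   value does not depend on it. *)
Definition edge_g (F : fieldType) (T : finType) (e : rel T) (f : F -> F)
    (phi : T -> T -> F) (A : {set T}) : F :=
  if [pick p : T * T | e p.1 p.2 && (A == [set p.1; p.2])] is Some p
  then gfun f (phi p.1 p.2) else 1.

Lemma edge_gE (F : fieldType) (T : finType) (e : rel T) (f : F -> F)
    (phi : T -> T -> F) (u v : T) :
  anti_involution f -> simple_graph e -> skew_gain e f phi -> e u v ->
  edge_g e f phi [set u; v] = gfun f (phi u v).
Proof.
move=> [_ fK _] [_ e_irr] e_phi e_uv; rewrite /edge_g.
case: pickP => [[a b] /= /andP[e_ab /eqP eq_uv]|/(_ (u, v))]; last first.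
  by rewrite /= e_uv eqxx.
have ab : a != b by apply: contraTneq e_ab => ->; rewrite e_irr.
have uv : u != v by apply: contraTneq e_uv => ->; rewrite e_irr.
have : a \in [set u; v] by rewrite eq_uv set21.
have : b \in [set u; v] by rewrite eq_uv set22.
have [phi_uv phi_vu] := e_phi _ _ e_uv.
rewrite !inE => /orP[]/eqP b_eq /orP[]/eqP a_eq; subst a b => //.
- by rewrite eqxx in ab.
- by rewrite /gfun phi_vu fK // mulrC.
- by rewrite eqxx in ab.
Qed.

(* A cycle v_0 v_1 ... v_(p-1) v_0 is given by the sequence of its vertices, so
   the same cycle subgraph has several such representations; the subgraph
   itself is identified by its set of edges. *)
Definition is_cycle (T : finType) (e : rel T) (c : seq T) : bool :=
  [&& cycle e c, uniq c & (2 < size c)%N].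

Definition cycle_edges (T : finType) (c : seq T) : {set {set T}} :=
  [set [set u; next c u] | u in c].

Definition unicyclic (T : finType) (e : rel T) : Prop :=
  (forall u v, connect e u v) /\
  exists! C : {set {set T}}, exists2 c, is_cycle e c & C = cycle_edges c.

Definition cycle_gain (F : fieldType) (T : finType) (phi : T -> T -> F)
    (c : seq T) : F :=
  \prod_(u <- c) phi u (next c u).

(* Main.v *)
(* Expand det(xI - A) over permutations s of the vertices. A term vanishes
   unless every vertex moved by s is sent to a neighbour, so every orbit of s
   with at least three points is a cycle of the graph, hence is C, on which s is
   the rotation or its inverse. If s is an involution it is a matching: its
   2-cycles are the edges, each contributing - g(phi(e)), and the fixed points
   contribute x. Otherwise s is a rotation of C, contributing - phi(C) or
   - f(phi(C)), times a matching of the graph without C. *)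
Require Import Defs.
From HB Require Import structures.
From mathcomp Require Import all_boot all_order all_algebra all_fingroup.

Set Implicit Arguments.
Unset Strict Implicit.
Unset Printing Implicit Defensive.

Import GRing.Theory.
Local Open Scope ring_scope.

(** * Counting the orbits of a permutation *)

Lemma porbits_partition (T : finType) (s : {perm T}) :
  partition (porbits s) [set: T].
Proof.
have -> : porbits s = orbit 'P <[s]>%g @: [set: T].
  by apply/setP=> A; apply/imsetP/imsetP => -[x _ ->]; exists x; rewrite ?porbitE.
by apply: orbit_partition; apply/actsP => a _ x; rewrite !inE.
Qed.

(** An orbit outside [M] is the singleton of a fixed point, because [M] covers all moved points. The
    sign of a permutation is read off its number of orbits, so this serves for parity
    computations. *)
Lemma card_porbits (T : finType) (s : {perm T}) (M : {set {set T}}) :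
  M \subset porbits s -> (forall x, s x != x -> x \in cover M) ->
  (#|porbits s| + #|cover M| = #|M| + #|T|)%N.
Proof.
move=> sMs cov; have part := porbits_partition s.
have triv := partition_trivIset part.
have /eqP <- : trivIset M by apply: trivIsetS triv.
have := card_partition part; rewrite cardsT => ->.
rewrite -(cardsID M (porbits s)) [in RHS](big_setID M) /= (setIidPr sMs) -addnA.

congr (_ + _)%N; rewrite addnC; congr (_ + _)%N; apply/esym.
rewrite -sum1_card; apply: eq_bigr => A /setDP[/imsetP[x _ ->] notM].
suff /eqP sx : s x == x.
  apply/eqP/cards1P; exists x; apply/setP => y; rewrite inE.
  apply/porbitP/eqP => [[k ->]|->]; last by exists 0%N; rewrite expg0 perm1.
  by elim: k => [|k IH]; rewrite ?expg0 ?perm1 // expgSr permM IH.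
apply: contraNT notM => /cov/bigcupP[B BM xB].
have /imsetP[y _ def_B] := subsetP sMs B BM.
by move: xB BM; rewrite def_B -eq_porbit_mem => /eqP ->.
Qed.

(** * Matchings as involutions moving vertices along edges *)

Definition matching_perm (T : finType) (e : rel T) : pred {perm T} :=
  fun t => [forall i, (t i != i) ==> (e i (t i) && (t (t i) == i))].

Definition perm_matching (T : finType) (t : {perm T}) : {set {set T}} :=
  [set [set i; t i] | i in [pred i | t i != i]].

Definition is_matching (T : finType) (e : rel T) : pred {set {set T}} :=
  fun M => (M \subset edges e) && trivIset M.

Section MatchingPerm.

Variables (T : finType) (e : rel T).
Implicit Types (s t : {perm T}) (M : {set {set T}}).

Lemma matching_permE t i : matching_perm e t -> t i != i -> e i (t i).
Proof. by move=> /forallP/(_ i)/implyP h /h/andP[]. Qed.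

Lemma matching_permK t : matching_perm e t -> involutive t.
Proof.
move=> /forallP h i; have [ti|ti] := eqVneq (t i) i; first by rewrite !ti.
by have /implyP/(_ ti)/andP[_ /eqP] := h i.
Qed.

Lemma perm_matching_pair t i j : involutive t -> i != j ->
  ([set i; j] \in perm_matching t) = (t i == j).
Proof.
move=> tK ij; apply/imsetP/eqP => [[k /= tk eq_ij]|tij]; last first.
  by exists i; rewrite ?inE tij // eq_sym.
have : i \in [set k; t k] by rewrite -eq_ij set21.
have : j \in [set k; t k] by rewrite -eq_ij set22.
rewrite !inE => /orP[]/eqP j_eq /orP[]/eqP i_eq; move: ij;
  by rewrite i_eq j_eq ?tK ?eqxx.
Qed.

(** A pair {i, j} with distinct ends belongs to the matching exactly when [t i = j], so the pairs
    determine [t]. *)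
Lemma perm_matching_inj :
  {in matching_perm e &, injective (@perm_matching T)}.
Proof.
move=> s t /matching_permK sK /matching_permK tK eq_st; apply/permP => i.
have [si|si] := eqVneq (s i) i; last first.
  by apply/esym/eqP; rewrite -perm_matching_pair // 1?eq_sym // -eq_st
     perm_matching_pair // 1?eq_sym.
have [ti|ti] := eqVneq (t i) i; first by rewrite si ti.
apply/eqP; rewrite -perm_matching_pair // 1?eq_sym // eq_st.
by rewrite perm_matching_pair // eq_sym.
Qed.

Lemma perm_matchingP t : symmetric e -> matching_perm e t ->
  is_matching e (perm_matching t).
Proof.
move=> e_sym mt; have tK := matching_permK mt; apply/andP; split.
  apply/subsetP => _ /imsetP[i /= ti ->]; apply/imsetP; exists (i, t i) => //.
  by rewrite inE /= matching_permE.
apply/trivIsetP => _ _ /imsetP[i _ ->] /imsetP[j _ ->].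
apply: contraNT; rewrite -setI_eq0 => /set0Pn[k].
have eq_pair l : k \in [set l; t l] -> [set l; t l] = [set k; t k].
  by rewrite !inE => /orP[]/eqP ->; rewrite ?tK // setUC.
by rewrite inE => /andP[/eq_pair -> /eq_pair ->].
Qed.

(** Exchange the ends of every edge of [M] and fix the other vertices; disjointness of the edges
    makes the partner of a vertex unique. *)
Lemma is_matching_perm M : symmetric e -> irreflexive e -> is_matching e M ->
  exists2 t, matching_perm e t & perm_matching t = M.
Proof.
move=> e_sym e_irr /andP[/subsetP sMe /trivIsetP triv].
have edgeM i j : [set i; j] \in M -> e i j.
  move=> /sMe/imsetP[[u v] /=]; rewrite inE /= => e_uv eq_ij.
  have uv : u != v by apply: contraTneq e_uv => ->; rewrite e_irr.
  have : u \in [set i; j] by rewrite eq_ij set21.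
  have : v \in [set i; j] by rewrite eq_ij set22.
  rewrite !inE => /orP[]/eqP v_eq /orP[]/eqP u_eq; subst u v => //.
  - by rewrite eqxx in uv.
  - by rewrite e_sym.
  - by rewrite eqxx in uv.
have uniqM i j k : [set i; j] \in M -> [set i; k] \in M -> j = k.
  move=> ijM ikM; have [eq_jk|neq_jk] := eqVneq [set i; j] [set i; k].
    have : j \in [set i; k] by rewrite -eq_jk set22.
    rewrite !inE => /orP[/eqP j_i|/eqP //].
    by move: (edgeM _ _ ijM); rewrite j_i e_irr.
  have := triv _ _ ijM ikM neq_jk; rewrite -setI_eq0 => /eqP/setP/(_ i).
  by rewrite !inE eqxx.
(* The partner of [i] in [M]; the default [i] makes unmatched vertices fixed points. *)
pose h i := odflt i [pick j | [set i; j] \in M].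
have hP i j : [set i; j] \in M -> h i = j.
  rewrite /h => ijM; case: pickP => [k /= ikM|/(_ j)]; last by rewrite ijM.
  exact: uniqM ikM ijM.
have hM i : h i != i -> [set i; h i] \in M.
  by rewrite /h; case: pickP => //=; rewrite eqxx.
have hK : involutive h.
  move=> i; have [hi|/hM ihM] := eqVneq (h i) i; first by rewrite !hi.
  by apply: hP; rewrite setUC.
exists (perm (inv_inj hK)).
  by apply/forallP => i; rewrite !permE hK eqxx andbT; apply/implyP => /hM/edgeM.
apply/setP => A; apply/imsetP/idP => [[i /=]|AM].
  by rewrite inE permE => hi ->; apply: hM.
have /imsetP[[i j] _ /= def_A] := sMe _ AM; move: AM; rewrite def_A => ijM.
exists i; rewrite ?inE permE (hP _ _ ijM) //.
by apply: contraTneq (edgeM _ _ ijM) => ->; rewrite e_irr.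
Qed.

Lemma cover_perm_matching t i : involutive t ->
  (i \in cover (perm_matching t)) = (t i != i).
Proof.
move=> tK; apply/bigcupP/idP => [[_ /imsetP[j /= tj ->]]|ti].
  by rewrite !inE => /orP[]/eqP ->; rewrite ?tK // eq_sym.
by exists [set i; t i]; rewrite ?set21 //; apply: imset_f.
Qed.

Lemma card_cover_matching M : irreflexive e -> is_matching e M ->
  #|cover M| = (2 * #|M|)%N.
Proof.
move=> e_irr /andP[/subsetP sMe /eqP <-].
rewrite (eq_bigr (fun=> 2%N)) ?sum_nat_const 1?mulnC // => A /sMe.
move=> /imsetP[[i j]]; rewrite inE /= => e_ij ->; rewrite cards2.
by case: eqVneq e_ij => // ->; rewrite e_irr.
Qed.

(** For a matching with k edges there are #|T| - k orbits, so the parity of #|T| plus the number of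
    orbits is that of k. *)
Lemma odd_matching_perm t : symmetric e -> irreflexive e -> matching_perm e t ->
  odd_perm t = odd #|perm_matching t|.
Proof.
move=> e_sym e_irr mt; have tK := matching_permK mt.
have cov : #|cover (perm_matching t)| = (2 * #|perm_matching t|)%N.
  by apply: card_cover_matching => //; apply: perm_matchingP.
have := @card_porbits _ t (perm_matching t).
rewrite /odd_perm cov mul2n => /(_ _ _)/(congr1 odd); rewrite !oddD odd_double addbF.
move=> -> //; first by rewrite addbC addbK.
  apply/subsetP => _ /imsetP[i /= ti ->]; apply/imsetP; exists i => //.
  apply/setP => j; apply/idP/porbitP => [|[k ->]].
    rewrite !inE => /orP[]/eqP ->; first by exists 0%N; rewrite expg0 perm1.
    by exists 1%N; rewrite expg1.
  elim: k => [|k]; first by rewrite expg0 perm1 set21.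
  by rewrite expgSr permM !inE => /orP[]/eqP ->; rewrite ?tK eqxx ?orbT.
by move=> i; rewrite cover_perm_matching.
Qed.

Lemma reindex_perm_matching (V : nmodType) (G : {set {set T}} -> V) :
  symmetric e -> irreflexive e ->
  \sum_(t | matching_perm e t) G (perm_matching t) =
  \sum_(M | is_matching e M) G M.
Proof.
move=> e_sym e_irr; rewrite -(big_imset G perm_matching_inj) /=.
apply: eq_bigl => M; apply/imsetP/idP => [[t mt ->]|].
  exact: perm_matchingP.
by case/is_matching_perm => // t mt <-; exists t.
Qed.

Lemma sum_matchings_by_size (V : nmodType) (G : {set {set T}} -> V) K :
  (forall M, is_matching e M -> (#|M| <= K)%N) ->
  \sum_(M | is_matching e M) G M =
  \sum_(0 <= k < K.+1) \sum_(M in matchings e k) G M.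
Proof.
move=> size_M; rewrite big_mkord.
(* The bound [K] keeps [inord] from replacing the size by its default. *)
rewrite (partition_big (fun M => inord #|M| : 'I_K.+1) predT) //=.
apply: eq_bigr => k _; apply: eq_bigl => M; rewrite inE andbA.
apply: andb_id2l => mM.
by rewrite -val_eqE /= inordK // ltnS size_M.
Qed.

End MatchingPerm.

(** * Contribution of matchings to the determinant of xI - A *)

Section CharPolyTerms.

Variables (F : fieldType) (f : F -> F) (hf : anti_involution f).
Variables (n : nat) (e : rel 'I_n) (he : simple_graph e).
Variables (phi : 'I_n -> 'I_n -> F) (hphi : skew_gain e f phi).

Let B := char_poly_mx (adjacency e phi).

Lemma char_poly_adj_diag i : B i i = 'X.
Proof. by rewrite !mxE eqxx he.2 subr0. Qed.

Lemma char_poly_adj_edge i j : e i j -> B i j = - (phi i j)%:P.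
Proof.
move=> eij; rewrite !mxE eij; case: eqVneq eij => [->|_ _]; last by rewrite sub0r.
by rewrite he.2.
Qed.

Lemma char_poly_adj_nonedge i j : i != j -> ~~ e i j -> B i j = 0.
Proof. by move=> /negPf ij /negPf eij; rewrite !mxE ij eij subr0. Qed.

Variable S : {pred 'I_n}.
Let e' := del_vertices e S.

Lemma card_predC_ord : (n - #|S|)%N = #|[predC S]|.
Proof. by rewrite -(addKn #|S| #|[predC S]|) cardC card_ord. Qed.

Lemma del_vertices_simple : symmetric e' /\ irreflexive e'.
Proof.
have [e_sym e_irr] := he; split=> [i j|i]; rewrite /e' /del_vertices /= ?e_irr // e_sym.
by rewrite [(i \notin S) && _]andbC.
Qed.

(** Moved vertices avoid [S]. The two entries of an edge multiply to g of its gain, their signs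
    cancelling, and each unmatched vertex outside [S] gives a factor X. *)
Lemma prod_matching_perm t : matching_perm e' t ->
  \prod_(i | i \notin S) B i (t i) =
  (\prod_(A in perm_matching t) edge_g e f phi A)%:P *
    'X^(n - (#|S| + 2 * #|perm_matching t|)).
Proof.
move=> mt; have tK := matching_permK mt; have [e'_sym e'_irr] := del_vertices_simple.
have mM := perm_matchingP e'_sym mt; have /andP[_ triv] := mM.
have movedP i : t i != i -> [/\ e i (t i), i \notin S & t i \notin S].
  by move/(matching_permE mt)/and3P.
rewrite (bigID (fun i => t i != i)) /=; congr (_ * _).
  rewrite (eq_bigl (mem (cover (perm_matching t)))) => [|i]; last first.
    rewrite /= cover_perm_matching // andb_idl // => /movedP[_ //].
  rewrite big_trivIset // rmorph_prod; apply: eq_bigr => _ /imsetP[i ti ->].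
  have [ei _ _] := movedP i ti; rewrite (edge_gE hf he hphi) // /gfun.
  rewrite big_setU1 ?inE 1?eq_sym // big_set1 tK.
  rewrite !char_poly_adj_edge // 1?he.1 //.
  by have [_ ->] := hphi ei; rewrite rmorphM; apply: mulrNN.
rewrite (eq_bigr (fun=> 'X)) => [|i /andP[_ /negPn/eqP ->]]; last first.
  exact: char_poly_adj_diag.
rewrite prodr_const; congr ('X^_); apply/esym/eqP.
rewrite -(card_cover_matching e'_irr mM) subnDA card_predC_ord.
rewrite -(cardID (mem (cover (perm_matching t))) [predC S]).
set a := #|_|; set b := #|_|; set c := #|_|.
have -> : a = c.
  apply: eq_card => i; rewrite !inE /= cover_perm_matching // andb_idl //.
  by case/movedP.
rewrite addKn; apply/eqP/eq_card => i.
by rewrite !inE /= cover_perm_matching // andbC.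
Qed.

(** Stated for a deleted set [S] so as to serve twice: with [S] empty for the coefficients a, and
    with [S] the vertices of the cycle for the coefficients b. *)
Lemma sum_matching_perm :
  \sum_(t | matching_perm e' t) (-1) ^+ t * \prod_(i | i \notin S) B i (t i) =
  \sum_(0 <= k < ((n - #|S|) %/ 2).+1)
    (\sum_(M in matchings e' k) (-1) ^+ k * \prod_(A in M) edge_g e f phi A)
      *: 'X^(n - (#|S| + 2 * k)).
Proof.
have [e'_sym e'_irr] := del_vertices_simple.
pose G (M : {set {set 'I_n}}) : {poly F} :=
  ((-1) ^+ #|M| * \prod_(A in M) edge_g e f phi A) *: 'X^(n - (#|S| + 2 * #|M|)).
rewrite (eq_bigr (fun t => G (perm_matching t))) => [|t mt]; last first.
  rewrite prod_matching_perm // (odd_matching_perm e'_sym) // /G -mul_polyC.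
  by rewrite signr_odd rmorphM rmorph_sign mulrA.
rewrite (reindex_perm_matching G) // (sum_matchings_by_size G (K := (n - #|S|) %/ 2)).
  apply: eq_bigr => k _; rewrite scaler_suml; apply: eq_bigr => M.
  by rewrite inE /G => /and3P[_ _ /eqP ->].
(* The 2#|M| covered vertices lie outside [S], which bounds the size of a matching. *)
move=> M mM; rewrite leq_divRL // mulnC -(card_cover_matching e'_irr mM).
rewrite card_predC_ord subset_leq_card //.
apply/subsetP => i /bigcupP[A /(subsetP (andP mM).1)/imsetP[[u v]]].
by rewrite !inE => /and3P[_ uS vS] -> /set2P[] ->.
Qed.

(* The permutations that agree with r on S and are matching involutions of the
   rest are the r * t with t a matching involution avoiding S. *)
Lemma sum_coset_matching_perm (r : {perm 'I_n}) :
  (forall i, i \in S -> r i \in S) -> (forall i, i \notin S -> r i = i) ->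
  \sum_(t | matching_perm e' t) (-1) ^+ (r * t)%g * \prod_i B i ((r * t)%g i) =
  ((-1) ^+ r * \prod_(i in S) B i (r i)) *
    \sum_(t | matching_perm e' t) (-1) ^+ t * \prod_(i | i \notin S) B i (t i).
Proof.
move=> rS rNS; rewrite mulr_sumr; apply: eq_bigr => t mt.
have tS i : i \in S -> t i = i.
  by move=> iS; apply: contraTeq iS => /(matching_permE mt)/and3P[].
rewrite odd_permM signr_addb mulrACA; congr (_ * _).
rewrite (bigID (mem S)) /=; congr (_ * _); apply: eq_bigr => i iS.
  by rewrite permM tS // rS.
by rewrite permM rNS.
Qed.

End CharPolyTerms.

(** * Orbits, cycles and the rotation of the unique cycle *)

(** Recovers the vertices of a cycle from its edge set, the only datum on which uniqueness in
    [unicyclic] bears. *)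
Lemma mem_cover_cycle_edges (T : finType) (c : seq T) i :
  (i \in cover (cycle_edges c)) = (i \in c).
Proof.
apply/bigcupP/idP => [[_ /imsetP[u uc ->]]|ic].
  by rewrite !inE => /orP[]/eqP ->; rewrite ?mem_next.
by exists [set i; next c i]; rewrite ?set21 //; apply/imsetP; exists i.
Qed.

(** The points [x], [s x] and [s (s x)] are distinct, which gives length at least three, and [s]
    moves every point of the orbit, hence along an edge. *)
Lemma orbit_is_cycle (T : finType) (e : rel T) (s : {perm T}) x :
  (forall i, s i != i -> e i (s i)) -> s (s x) != x -> is_cycle e (fingraph.orbit s x).
Proof.
move=> s_e ssx; have sx : s x != x by apply: contraNneq ssx => sx; rewrite !sx.
have moved y : y \in fingraph.orbit s x -> s y != y.
  move=> /trajectP[k _ ->]; elim: k => // k IH.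
  by rewrite iterS (inj_eq perm_inj).
apply/and3P; split; last 1 first.
- have sub : {subset [:: x; s x; s (s x)] <= fingraph.orbit s x}.
    by move=> y; rewrite !inE => /or3P[]/eqP ->; do ?apply: fingraph.mem_orbit; apply: fingraph.in_orbit.
  apply: (uniq_leq_size _ sub); rewrite /= !inE negb_or andbT !(eq_sym x) sx ssx /=.
  by rewrite (inj_eq perm_inj) eq_sym.
- apply: (@cycle_from_next _ e); first exact: fingraph.orbit_uniq.
  move=> y y_x; rewrite (nextE (cycle_orbit perm_inj x) y_x).
  by apply/s_e/moved.
exact: fingraph.orbit_uniq.
Qed.

Section CycleRotation.

Variables (T : finType) (e : rel T) (C : seq T) (hC : is_cycle e C).

Let uniqC : uniq C. Proof. by case/and3P: hC. Qed.

(** [next] fixes what is not on [C] and has inverse [prev], so it is a permutation of all of [T]. *)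
Definition cycle_rotation : {perm T} := perm (can_inj (prev_next uniqC)).
Let r := cycle_rotation.

Lemma cycle_rotationE : r =1 next C.
Proof. by move=> i; rewrite permE. Qed.

Lemma cycle_rotationV : (r^-1)%g =1 prev C.
Proof.
by move=> i; apply: (@perm_inj _ r); rewrite permKV cycle_rotationE next_prev.
Qed.

(** This rests on length at least three, and separates the rotation both from involutions and from
    its own inverse. *)
Lemma cycle_rotation_sq i : i \in C -> r (r i) != i.
Proof.
(* Rotating the sequence to begin with [i] does not change [next]. *)
rewrite !cycle_rotationE => /rot_to[k c def_c].
have: uniq (i :: c) by rewrite -def_c rot_uniq.
have: (2 < size (i :: c))%N by rewrite -def_c size_rot; case/and3P: hC.
rewrite -!(next_rot k uniqC) def_c; case: c {def_c} => [|y [|z c]] //= _.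
rewrite eqxx !inE !negb_or => /andP[/and3P[iy iz _] _].
by rewrite (eq_sym y) (negPf iy) eqxx eq_sym.
Qed.

Lemma cycle_rotation_mem i : (r i \in C) = (i \in C).
Proof. by rewrite cycle_rotationE mem_next. Qed.

Lemma cycle_rotationV_mem i : ((r^-1)%g i \in C) = (i \in C).
Proof. by rewrite cycle_rotationV mem_prev. Qed.

Lemma cycle_rotation_out i : i \notin C -> r i = i.
Proof. by rewrite cycle_rotationE next_nth => /negPf ->. Qed.

Lemma cycle_rotationV_out i : i \notin C -> (r^-1)%g i = i.
Proof. by rewrite cycle_rotationV prev_nth => /negPf ->. Qed.

(** The cycle is one orbit and all else is fixed, so for length p the parity is that of p - 1. *)
Lemma odd_cycle_rotation : odd_perm r = ~~ odd (size C).
Proof.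
have [x xC] : exists x, x \in C.
  by case/and3P: hC; case: C => [|x c] // _ _ _; exists x; rewrite mem_head.
have fC : fcycle r C.
  apply: (@cycle_from_next _ (frel r)) => // i _ /=.
  by rewrite cycle_rotationE.
have porbC : porbit r x = [set i in C].
  apply/setP => i; rewrite inE -(fconnect_cycle fC xC).
  apply/porbitP/connectP => [[k ->]|[c /fpathP[k ->] ->]].
    exists (traject r (r x) k); first by rewrite fpath_traject.
    by rewrite last_traject permX.
  by exists k; rewrite last_traject permX.
have := @card_porbits _ r [set [set i in C]]; rewrite cards1 cover1.
rewrite cardsE (card_uniqP uniqC) => /(_ _ _)/(congr1 odd); rewrite !oddD /= => H.
rewrite /odd_perm addbC; apply: (can_inj (addbK (odd (size C)))).
rewrite addbAC H //; first by rewrite !addNb !addbb.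
  by rewrite sub1set -porbC imset_f.
by move=> i ri; rewrite inE; apply: contraNT ri => /cycle_rotation_out ->.
Qed.

Section Unicyclic.

Hypothesis hU : unicyclic e.
Variable s : {perm T}.
Hypothesis s_e : forall i, s i != i -> e i (s i).
Variable x : T.
Hypothesis ssx : s (s x) != x.

(** The orbit is itself a cycle of the graph, so uniqueness applies. *)
Let edges_orbit : cycle_edges (fingraph.orbit s x) = cycle_edges C.
Proof.
have [_ [E [_ uniqE]]] := hU; rewrite -(uniqE (cycle_edges C)); last by exists C.
by apply/esym/uniqE; exists (fingraph.orbit s x) => //; apply: orbit_is_cycle.
Qed.

Lemma nonmatching_orbit : fingraph.orbit s x =i C.
Proof. by move=> i; rewrite -!mem_cover_cycle_edges edges_orbit. Qed.

(** The pair {j, s j} is an edge of [C], and the only neighbours of [j] along [C] are its successor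
    and predecessor. *)
Lemma nonmatching_step j : j \in C -> s j = r j \/ s j = (r^-1)%g j.
Proof.
rewrite -nonmatching_orbit => jx.
have ssj : s (s j) != j.
  move/trajectP: jx => [k _ ->]; elim: k => // k IH.
  by rewrite iterS (inj_eq perm_inj).
have sj : s j != j by apply: contraNneq ssj => sj; rewrite !sj.
have : [set j; s j] \in cycle_edges C.
  rewrite -edges_orbit; apply/imsetP; exists j => //.
  by rewrite (nextE (cycle_orbit perm_inj x) jx).
rewrite cycle_rotationE cycle_rotationV => /imsetP[u _ eq_ju].
have : j \in [set u; next C u] by rewrite -eq_ju set21.
have : s j \in [set u; next C u] by rewrite -eq_ju set22.
rewrite !inE => /orP[]/eqP sj_eq /orP[]/eqP j_eq.
- by rewrite sj_eq j_eq eqxx in sj.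
- by right; rewrite sj_eq j_eq prev_next.
- by left; rewrite sj_eq j_eq.
- by rewrite sj_eq -j_eq eqxx in sj.
Qed.

(* If s follows rho at y and its inverse at s y, then s (s y) = y, which is
   excluded on the orbit of x: hence s follows the same direction throughout. *)
Lemma nonmatching_direction (rho : {perm T}) :
    (forall j, j \in C -> s j = rho j \/ s j = (rho^-1)%g j) ->
  s x = rho x -> {in C, s =1 rho}.
Proof.
move=> step sx j; rewrite -nonmatching_orbit => /trajectP[k _ ->].
have ssk : s (s (iter k s x)) != iter k s x.
  by elim: k => // k IH; rewrite iterS (inj_eq perm_inj).
elim: k ssk => // k IH; rewrite !iterS (inj_eq perm_inj) => ssk.
have yC : s (iter k s x) \in C.
  by rewrite -nonmatching_orbit -iterS -fconnect_orbit fconnect_iter.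
have [//|eq_s] := step _ yC.
by have sy := IH ssk; case/eqP: ssk; rewrite eq_s sy permK.
Qed.

Lemma nonmatching_rotation : {in C, s =1 r} \/ {in C, s =1 (r^-1)%g}.
Proof.
have xC : x \in C by rewrite -nonmatching_orbit fingraph.in_orbit.
have [sx|sx] := nonmatching_step xC.
  by left; apply: nonmatching_direction sx => j /nonmatching_step.
right; apply: nonmatching_direction sx => j /nonmatching_step.
by rewrite invgK => -[]; [right|left].
Qed.

End Unicyclic.

End CycleRotation.

(** Products act from left to right: on [C], [s] undoes [rho^-1], and off [C] only [s] remains, an
    involution along edges. *)
Lemma matching_perm_off_cycle (T : finType) (e : rel T) (C : seq T)
    (rho s : {perm T}) :
    (forall i, (rho^-1%g i \in C) = (i \in C)) ->
    (forall i, i \notin C -> rho^-1%g i = i) ->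
    (forall i, s i != i -> e i (s i)) ->
    (forall i, i \notin C -> s (s i) = i) -> {in C, s =1 rho} ->
  matching_perm (del_vertices e (mem C)) (rho^-1 * s)%g.
Proof.
move=> rhoC rhoNC s_e ssNC s_rho; apply/forallP => i; apply/implyP.
rewrite !permM; have [iC|iNC] := boolP (i \in C).
  by rewrite s_rho ?rhoC // permKV eqxx.
rewrite rhoNC // => si.
(* If [s i] were on [C], it would also be the image of a point of [C], which injectivity would force
   to be [i]. *)
have siNC : s i \notin C.
  apply: contra iNC => siC; have : s ((rho^-1)%g (s i)) = s i.
    by rewrite s_rho ?rhoC // permKV.
  by move/perm_inj => <-; rewrite rhoC.
by rewrite /del_vertices /= s_e // iNC siNC rhoNC // ssNC /=.
Qed.

(** * Weights of the two rotations of the cycle *)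

Lemma anti_involution1 (F : fieldType) (f : F -> F) :
  anti_involution f -> f 1 = 1.
Proof.
case=> f_neq0 _ fM; apply: (mulfI (f_neq0 1 (oner_neq0 F))).
by rewrite -fM ?oner_neq0 // !mulr1.
Qed.

(** The reversal of factors is absorbed by commutativity of the field. *)
Lemma anti_involution_prod (F : fieldType) (f : F -> F) (I : eqType)
    (s : seq I) (G : I -> F) :
  anti_involution f -> (forall i, i \in s -> G i != 0) ->
  f (\prod_(i <- s) G i) = \prod_(i <- s) f (G i).
Proof.
move=> hf; elim: s => [|i s IH] G_neq0.
  by rewrite !big_nil anti_involution1.
have Gs j : j \in s -> G j != 0 by move=> js; rewrite G_neq0 // inE js orbT.
case: (hf) => _ _ fM; rewrite !big_cons fM ?G_neq0 ?mem_head //.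
  by rewrite IH // mulrC.
by rewrite prodf_seq_neq0; apply/allP => j /Gs.
Qed.

Section CycleWeight.

Variables (F : fieldType) (f : F -> F) (hf : anti_involution f).
Variables (n : nat) (e : rel 'I_n) (he : simple_graph e).
Variables (phi : 'I_n -> 'I_n -> F) (hphi : skew_gain e f phi).
Variables (C : seq 'I_n) (hC : is_cycle e C).

Let B := char_poly_mx (adjacency e phi).
Let r := cycle_rotation hC.
Let cycC : path.cycle e C. Proof. by case/and3P: hC. Qed.
Let uniqC : uniq C. Proof. by case/and3P: hC. Qed.

(** For length p the rotation has sign (-1)^(p-1) and the negated factors contribute (-1)^p, leaving
    a single minus sign whatever p is. *)
Lemma cycle_sign (G : 'I_n -> F) :
  (-1) ^+ r * \prod_(i <- C) - (G i)%:P = - (\prod_(i <- C) G i)%:P.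
Proof.
rewrite big_tnth prodrN card_ord mulrA -(big_tnth _ _ _ xpredT (fun i => (G i)%:P)).
rewrite -(signr_odd _ (size C)) -signr_addb (odd_cycle_rotation hC) addNb addbb mulN1r.
by rewrite rmorph_prod.
Qed.

Lemma cycle_rotation_weight :
  (-1) ^+ r * \prod_(i in mem C) B i (r i) = - (cycle_gain phi C)%:P.
Proof.
rewrite -(big_uniq _ uniqC) /= -cycle_sign; congr (_ * _).
apply: eq_big_seq => i iC.
by rewrite cycle_rotationE (char_poly_adj_edge he) // next_cycle.
Qed.

Lemma cycle_rotationV_weight :
  (-1) ^+ (r^-1)%g * \prod_(i in mem C) B i ((r^-1)%g i) =
  - (f (cycle_gain phi C))%:P.
Proof.
have gain_neq0 i : i \in C -> phi i (next C i) != 0.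
  by move=> iC; case: (hphi (next_cycle cycC iC)).
rewrite odd_permV anti_involution_prod // -cycle_sign; congr (_ * _).
(* After reindexing by [r] each factor is the entry of an edge traversed backwards, from [next C i]
   to [i], whose gain is f of the forward one. *)
rewrite (big_uniq _ uniqC) /= (reindex_inj (@perm_inj _ r)) /=.
apply: eq_big => [i|i iC]; first exact: cycle_rotation_mem.
have e_next : e i (next C i).
  by apply: next_cycle => //; rewrite -(cycle_rotation_mem hC).
rewrite permK cycle_rotationE (char_poly_adj_edge he) 1?he.1 //.
by case: (hphi e_next) => _ ->.
Qed.

End CycleWeight.

(** * Decomposition of the determinant by classes of permutations *)

(** The three classes of permutations are disjoint, and a permutation in none of them uses a
    non-edge, so its term is zero. *)
Lemma det_unicyclic_split (F : fieldType) (n : nat) (e : rel 'I_n)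
    (hU : unicyclic e) (C : seq 'I_n) (hC : is_cycle e C) (B : 'M[{poly F}]_n) :
    (forall i j, i != j -> ~~ e i j -> B i j = 0) ->
  let wt (s : {perm 'I_n}) := (-1) ^+ s * \prod_i B i (s i) in
  let r := cycle_rotation hC in
  let e' := del_vertices e (mem C) in
  \det B = \sum_(s | matching_perm e s) wt s
    + \sum_(t | matching_perm e' t) wt (r * t)%g
    + \sum_(t | matching_perm e' t) wt (r^-1 * t)%g.
Proof.
move=> B0 wt r e'.
(* [Q rho] describes the products [rho * t], with [t] a matching involution off [C], as a condition
   on the product itself. *)
pose Q (rho : {perm 'I_n}) := [pred s | matching_perm e' (rho^-1 * s)%g].
have reindexQ rho : \sum_(t | matching_perm e' t) wt (rho * t)%g =
                    \sum_(s | Q rho s) wt s.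
  rewrite [RHS](reindex_inj (mulgI rho)) /=.
  by apply: eq_bigl => t; rewrite mulKg.
have [x xC] : exists x, x \in C.
  by case/and3P: (hC); case: (C) => [|x c] // _ _ _; exists x; rewrite mem_head.
have QC (rho s : {perm 'I_n}) j : (forall i, (rho i \in C) = (i \in C)) -> Q rho s -> j \in C ->
    s j = rho j.
  move=> rhoC mt jC; rewrite -{1}(mulKVg rho s) permM.
  by apply: contraTeq jC => /(matching_permE mt)/and3P[_]; rewrite rhoC.
have rC := cycle_rotation_mem hC; have rVC := cycle_rotationV_mem hC.
(* Disjointness is tested at one vertex [x] of [C]: the square of the rotation moves [x], so [s] can
   neither be an involution nor follow both directions there. *)
have notQ : forall s, Q r s -> ~~ matching_perm e s.
  move=> s Qs; apply: contra (cycle_rotation_sq hC xC) => /matching_permK sK.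
  by have := sK x; rewrite !(QC r s) ?rC // => ->.
have notQV : forall s, Q (r^-1)%g s -> ~~ matching_perm e s.
  move=> s Qs; apply: contra (cycle_rotation_sq hC xC) => /matching_permK sK.
  have := sK x; rewrite !(QC (r^-1)%g s) ?rVC // => eq_x.
  by rewrite -{1}eq_x !permKV.
have QQV : forall s, Q (r^-1)%g s -> ~~ Q r s.
  move=> s QVs; apply: contra (cycle_rotation_sq hC xC) => Qs.
  have := QC r s x rC Qs xC; rewrite (QC _ _ _ rVC QVs xC) => eq_x.
  by rewrite -eq_x permKV.
rewrite !reindexQ /determinant (bigID (matching_perm e)) /= -!addrA; congr (_ + _).
rewrite (bigID (Q r)) /=; congr (_ + _).
  by apply: eq_bigl => s; rewrite andb_idl // => /notQ.
rewrite (bigID (Q (r^-1)%g)) /= [X in _ + X]big1 => [|s /andP[/andP[sN QN] QVN]].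
  rewrite addr0; apply: eq_bigl => s; rewrite andb_idl // => QVs.
  by rewrite notQV // QQV.
(* For [s] in none of the classes, a move along a non-edge gives a zero factor; otherwise [s] is
   shown to lie in a class after all. *)
have [|] := boolP [forall i, (s i != i) ==> e i (s i)]; last first.
  rewrite negb_forall => /existsP[i]; rewrite negb_imply => /andP[si es].
  by rewrite (bigD1 i) //= B0 1?eq_sym // mul0r mulr0.
move=> /forallP s_e'; have s_e i : s i != i -> e i (s i) by apply/implyP.
have [y ssy] : exists y, s (s y) != y.
  move: sN; rewrite /matching_perm negb_forall => /existsP[y].
  by rewrite negb_imply => /andP[sy]; rewrite s_e //= => ssy; exists y.
(* A point not returned after two steps has the vertices of [C] as its orbit. *)
have ssNC i : i \notin C -> s (s i) = i.
  apply: contraNeq => ssi; rewrite -(nonmatching_orbit hC hU s_e ssi).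
  exact: fingraph.in_orbit.
case: (nonmatching_rotation hC hU s_e ssy) => s_rho.
  case/negP: QN; apply: matching_perm_off_cycle => //.
  exact: cycle_rotationV_out.
case/negP: QVN; apply: matching_perm_off_cycle => // i; rewrite invgK.
  exact: cycle_rotation_mem.
exact: cycle_rotation_out.
Qed.

(** * Assembling the coefficients of the characteristic polynomial *)

Theorem theorem2p8 (F : fieldType) (charF0 : [pchar F] =i pred0)
    (f : F -> F) (hf : anti_involution f)
    (n : nat) (e : rel 'I_n) (he : simple_graph e) (hU : unicyclic e)
    (phi : 'I_n -> 'I_n -> F) (hphi : skew_gain e f phi)
    (p : nat) (C : seq 'I_n) (hC : is_cycle e C) (hp : size C = p) :
  let a (i : nat) : F :=
    \sum_(M in matchings e i) (-1) ^+ i * \prod_(A in M) edge_g e f phi A in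
  let b (i : nat) : F :=
    (cycle_gain phi C + f (cycle_gain phi C)) *
    \sum_(M in matchings (del_vertices e (mem C)) i)
       (-1) ^+ i.+1 * \prod_(A in M) edge_g e f phi A in
  char_poly (adjacency e phi) =
    'X^n + \sum_(1 <= i < (n %/ 2).+1) a i *: 'X^(n - 2 * i)
         + \sum_(0 <= i < ((n - p) %/ 2).+1) b i *: 'X^(n - (p + 2 * i)).
Proof.
move=> a b; have [e_sym e_irr] := he.
(* The empty matching alone gives coefficient 1, which yields the leading term. *)
have a0 : a 0 = 1.
  rewrite /a (big_pred1 set0) => [|M]; first by rewrite big_set0 expr0 mulr1.
  rewrite inE /= cards_eq0; apply/and3P/eqP => [[_ _ /eqP] //|->].
  by rewrite sub0set eqxx; split=> //; apply/trivIsetP => A B; rewrite inE.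
rewrite /char_poly (det_unicyclic_split hU hC (char_poly_adj_nonedge phi)).
(* With nothing deleted the relation agrees with [e] pointwise; matching permutations and edge sets
   are then transferred separately. *)
pose S0 : {pred 'I_n} := pred0.
have e'e : del_vertices e S0 =2 e by move=> i j; rewrite /del_vertices /= andbT.
have mp_e' t : matching_perm (del_vertices e S0) t = matching_perm e t.
  by apply: eq_forallb => i; rewrite e'e.
have edges_e' : edges (del_vertices e S0) = edges e.
  apply/setP => A; apply/imsetP/imsetP => -[p0];
  by rewrite inE /= => ep ->; exists p0; rewrite // inE /= -?e'e // e'e.
have -> : \sum_(s | matching_perm e s) (-1) ^+ s *
    \prod_i char_poly_mx (adjacency e phi) i (s i) =
    'X^n + \sum_(1 <= i < (n %/ 2).+1) a i *: 'X^(n - 2 * i).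
  have := sum_matching_perm hf he hphi S0.
  rewrite card0 subn0 (eq_bigl _ _ mp_e') => ->.
  rewrite big_nat_recl // /matchings edges_e' -/(matchings e 0) -/(a 0) a0.
  by rewrite scale1r muln0 addn0 subn0 big_add1.
rewrite -addrA; congr (_ + _).
have cardC : #|mem C| = p by rewrite -hp; apply/card_uniqP; case/and3P: hC.
have memC i : (i \in mem C) = (i \in C) by [].
have rC := cycle_rotation_mem hC; have rVC := cycle_rotationV_mem hC.
have rNC := cycle_rotation_out hC; have rVNC := cycle_rotationV_out hC.
(* Each rotation factors out of its class, and both leave the same sum over matchings off [C]; the
   two weights add up to minus the bracket in [b]. *)
rewrite !sum_coset_matching_perm //; try by move=> i; rewrite !memC ?rC ?rVC.
rewrite (cycle_rotation_weight he) (cycle_rotationV_weight hf he hphi).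
rewrite (sum_matching_perm hf he hphi) -mulrDl -opprD -rmorphD mulr_sumr.
rewrite cardC; apply: eq_bigr => k _.
rewrite mulNr mul_polyC scalerA -scaleNr /b; congr (_ *: _).
(* The minus sign of the cycle raises the exponent of -1 from k to k + 1. *)
rewrite -mulrN -sumrN; congr (_ * _); apply: eq_bigr => M _.
by rewrite exprS mulN1r mulNr.
Qed.
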